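(* Let $G_1$ be a finite, simple, connected, non-complete graph and let $G_2$ be a finite simple graph. If $k_1(G_1)=k(G_1)$, then $k_1(G_1\circ G_2)=k(G_1\circ G_2)$.
   Context: All graphs are finite, simple and undirected. For a graph $G$, a set $S\subseteq V(G)$ is a vertex-cut of $G$ if $G-S$ is disconnected or $G-S$ is the trivial graph $K_1$. The connectivity $k(G)$ is the minimum cardinality of a vertex-cut of $G$. A vertex-cut $S$ of $G$ is a $k_1$-vertex-cut if $G-S$ has no isolated vertices; the $k_1$-connectivity $k_1(G)$ is the minimum cardinality of a $k_1$-vertex-cut of $G$, with $k_1(G)=\infty$ if no $k_1$-vertex-cut exists. The lexicographic product $G_1\circ G_2$ has vertex set $V(G_1)\times V(G_2)$, where $(x_1,y_1)$ and $(x_2,y_2)$ are adjacent if and only if either $x_1x_2\in E(G_1)$, or $x_1=x_2$ and $y_1y_2\in E(G_2)$. *)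

(* Defs.v *)
From mathcomp Require Import all_boot.

Set Implicit Arguments.
Unset Strict Implicit.
Unset Printing Implicit Defensive.

Record sgraph := SGraph {
  vertex :> finType;
  adj : rel vertex;
  adj_sym : symmetric adj;
  adj_irr : irreflexive adj }.

Definition complete (G : sgraph) : bool :=
  [forall x : G, forall y : G, (x != y) ==> adj x y].

(* The graph without vertices is connected in this sense, so deleting all the
   vertices of a graph does not count as disconnecting it. *)
Definition connected (G : sgraph) : bool :=
  [forall x : G, forall y : G, connect (@adj G) x y].

Definition isolated (G : sgraph) (x : G) : bool :=
  [forall y : G, ~~ adj x y].

Section DeleteVertices.
Variables (G : sgraph) (S : {set G}).

Definition delete_vertex : finType := {x : G | x \notin S}.
Definition delete_adj : rel delete_vertex := fun x y => adj (val x) (val y).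

Lemma delete_adj_sym : symmetric delete_adj.
Proof. by move=> x y; apply: adj_sym. Qed.

Lemma delete_adj_irr : irreflexive delete_adj.
Proof. by move=> x; apply: adj_irr. Qed.

Definition delete : sgraph := SGraph delete_adj_sym delete_adj_irr.
End DeleteVertices.

Section LexicographicProduct.
Variables G1 G2 : sgraph.

Definition lex_adj : rel (G1 * G2) := fun u v =>
  adj u.1 v.1 || (u.1 == v.1) && adj u.2 v.2.

Lemma lex_adj_sym : symmetric lex_adj.
Proof.
by move=> u v; rewrite /lex_adj eq_sym (adj_sym u.1) (adj_sym u.2).
Qed.

Lemma lex_adj_irr : irreflexive lex_adj.
Proof. by move=> u; rewrite /lex_adj !adj_irr andbF. Qed.

Definition lex_product : sgraph := SGraph lex_adj_sym lex_adj_irr.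
End LexicographicProduct.

Definition vertex_cut (G : sgraph) (S : {set G}) : bool :=
  ~~ connected (delete S) || (#|delete S| == 1).

Definition k1_vertex_cut (G : sgraph) (S : {set G}) : bool :=
  vertex_cut S && [forall x : delete S, ~~ isolated x].

(* [Some m] is the natural number m and [None] is infinity, the minimum over
   an empty family. *)
Definition min_card (T : finType) (P : pred {set T}) : option nat :=
  if [pick S | P S] is Some S0
  then Some #|[arg min_(S < S0 | P S) #|S|]| else None.

Lemma min_cardP (T : finType) (P : pred {set T}) (m : nat) :
  min_card P = Some m <->
  (exists2 S, P S & #|S| = m) /\ (forall S, P S -> m <= #|S|).
Proof.
rewrite /min_card; case: pickP => [S0 PS0 | P0]; last first.
  by split=> // -[[S PS _] _]; rewrite P0 in PS.
case: arg_minnP => // S PS minS; split=> [[<-] | [[S' PS' <-] minm]].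
  by split=> //; exists S.
by congr Some; apply/eqP; rewrite eqn_leq minS ?minm.
Qed.

Lemma min_card_infty (T : finType) (P : pred {set T}) :
  min_card P = None <-> (forall S, ~~ P S).
Proof.
rewrite /min_card; case: pickP => [S0 PS0 | P0].
  by split=> // /(_ S0); rewrite PS0.
by split=> // _ S; rewrite P0.
Qed.

Definition connectivity (G : sgraph) : option nat := min_card (@vertex_cut G).

Definition k1_connectivity (G : sgraph) : option nat :=
  min_card (@k1_vertex_cut G).

Lemma connectivity_fin (G : sgraph) : 0 < #|G| -> connectivity G <> None.
Proof.
case/card_gt0P=> x _ /min_card_infty /(_ [set~ x]) /negP; apply.
rewrite /vertex_cut; apply/orP; right.
by rewrite card_sig (eq_card (B := pred1 x)) ?card1 // => y; rewrite !inE negbK.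
Qed.

(* Main.v *)
(** The cut [S] of [G1] lifts to the union of the fibres over [S], which is
    [#|G2|] times as large and leaves no isolated vertex if [S] leaves none.
    Conversely, if [T] cuts the product, then the vertices of [G1] whose whole
    fibre lies in [T] cut [G1]: a path between distinct vertices avoiding these
    fibres lifts to a path avoiding [T] with arbitrary endpoints over its ends.
    Hence the connectivity of the product is [#|G2|] times that of [G1], and it
    is attained by the lift of a minimum cut without isolated vertices. *)
Require Import Defs.
From mathcomp Require Import all_boot.

(** An edge may go to a path, even one of length zero: the projection of the product onto [G1]
    collapses the edges inside a fibre. *)
Lemma connect_homo (T U : finType) (e : rel T) (e' : rel U) (f : T -> U) :
  (forall x y, e x y -> connect e' (f x) (f y)) ->
  forall x y, connect e x y -> connect e' (f x) (f y).
Proof.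
move=> homo x y /connectP[s es ->]; elim: s x es => [|z s IHs] x //=.
by case/andP=> /homo exz /IHs; apply: connect_trans.
Qed.

(** A lone remaining vertex is isolated, which rules out the [K_1] alternative of [vertex_cut]. *)
Lemma k1_vertex_cutE (G : sgraph) (S : {set G}) :
  k1_vertex_cut S =
  ~~ connected (delete S) && [forall x : delete S, ~~ isolated x].
Proof.
rewrite /k1_vertex_cut /vertex_cut.
case: (connected _) => //=; apply/negP => /andP[/eqP card1 /forallP noiso].
have /fintype1[x unx] : #|delete S| = 1 by [].
case/negP: (noiso x); apply/forallP=> y.
by rewrite (unx y) adj_irr.
Qed.

Section LexicographicCuts.
Variables G1 G2 : sgraph.
Local Notation L := (lex_product G1 G2).

Definition fibres (S : {set G1}) : {set L} := [set p | p.1 \in S].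

Definition full_fibres (T : {set L}) : {set G1} :=
  [set x | [forall y : G2, (x, y) \in T]].

Lemma card_fibres (S : {set G1}) : #|fibres S| = #|S| * #|G2|.
Proof.
rewrite -[#|G2|]cardsT -cardsX; apply: eq_card => -[x y].
by rewrite !inE andbT.
Qed.

Lemma leq_card_full_fibres (T : {set L}) : #|full_fibres T| * #|G2| <= #|T|.
Proof.
rewrite -card_fibres; apply/subset_leq_card/subsetP => -[x y].
by rewrite !inE => /forallP; apply.
Qed.

Lemma fibres_k1_vertex_cut (S : {set G1}) :
  0 < #|G2| -> k1_vertex_cut S -> k1_vertex_cut (fibres S).
Proof.
case/card_gt0P=> y0 _; rewrite !k1_vertex_cutE => /andP[disc /forallP noiso].
have out x y : x \notin S -> ((x, y) : L) \notin fibres S by rewrite inE.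
have out1 (p : delete (fibres S)) : (val p).1 \notin S.
  by have := valP p; rewrite inE.
pose up (a : delete S) y : delete (fibres S) :=
  Sub ((val a, y) : L) (out _ y (valP a)).
pose down (p : delete (fibres S)) : delete S := Sub (val p).1 (out1 p).
have upK a y : down (up a y) = a by apply: val_inj.
apply/andP; split; last first.
  (* A neighbour [b] of the projection of [p] makes every vertex over [b] a neighbour of [p], so the
     second coordinate [y0] is arbitrary. *)
  apply/forallP=> p; have /forallPn[b] := noiso (down p); rewrite negbK => pb.
  by apply/forallPn; exists (up b y0); rewrite negbK; apply/orP; left.
apply: contraNN disc => /forallP conn.
apply/forallP=> a; apply/forallP=> b; rewrite -(upK a y0) -(upK b y0).
have /forallP/(_ (up b y0)) := conn (up a y0); apply: connect_homo => p q.
case/orP=> [pq | /andP[/eqP pq _]]; first exact: connect1.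
by have -> : down p = down q by apply: val_inj.
Qed.

Lemma full_fibres_vertex_cut (T : {set L}) :
  vertex_cut T -> vertex_cut (full_fibres T).
Proof.
set U := full_fibres T; move=> cutT; apply/negPn/negP.
rewrite /vertex_cut negb_or negbK => /andP[/forallP connU cardU].
have out (p : delete T) : (val p).1 \notin U.
  rewrite inE; apply/forallPn; exists (val p).2.
  by rewrite -surjective_pairing (valP p).
pose down (p : delete T) : delete U := Sub (val p).1 (out p).
have over (a : delete U) : exists p, down p = a.
  have := valP a; rewrite inE => /forallPn[y aT].
  by exists (Sub ((val a, y) : L) aT); apply: val_inj.
have lift p q : down p != down q -> connect (@adj (delete T)) p q.
  have /forallP/(_ (down q))/connectP[s] := connU (down p).
  elim: s p => [|c s IHs] p /=; first by move=> _ ->; rewrite eqxx.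
  case/andP=> pc path_s lastq _.
  (* Once the path reaches the fibre of [q], it steps to [q] itself; before that, any remaining
     vertex over [c] will do. *)
  have [cq | cq] := eqVneq c (down q).
    by apply: connect1; rewrite cq in pc; apply/orP; left.
  have [r rc] := over c; apply: (connect_trans (y := r)).
    by rewrite -rc in pc; apply: connect1; apply/orP; left.
  by apply: IHs; rewrite rc.
(* Were [a] the only vertex left, [U] would be a vertex-cut through the [K_1] alternative. *)
have other (a : delete U) : exists b : delete U, b != a.
  apply/existsP; apply: contraNT cardU; rewrite negb_exists => /forallP all_a.
  apply/eqP; rewrite -(card1 a); apply: eq_card => b.
  by rewrite !inE; have := all_a b; rewrite negbK => ->.
case/orP: cutT => [/negP[] | /eqP cardT].
  apply/forallP=> p; apply/forallP=> q.
  have [pq | /lift//] := eqVneq (down p) (down q).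
  (* Two vertices of the same fibre are joined by a detour through a vertex [r] of another fibre. *)
  have [b bp] := other (down p); have [r rb] := over b.
  apply: (connect_trans (y := r)); apply: lift; rewrite rb ?[_ == b]eq_sym //.
  by rewrite -pq.
have /fintype1[p unp] : #|delete T| = 1 by [].
have [b] := other (down p); have [q <-] := over b.
by rewrite (unp q) eqxx.
Qed.

End LexicographicCuts.

Theorem theorem2p2 (G1 G2 : sgraph)
  (G1_connected : connected G1) (G1_noncomplete : ~~ complete G1)
  (k1G1 : k1_connectivity G1 = connectivity G1) :
  k1_connectivity (lex_product G1 G2) = connectivity (lex_product G1 G2).
Proof.
(* For empty [G2] the product is empty and has no vertex-cut, so both sides are infinite. *)
have [G2_0 | G2_gt0] := posnP #|G2|.
  have L0 : lex_product G1 G2 -> False.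
    by case=> _ y; have := card0_eq G2_0 y; rewrite inE.
  have nocut (S : {set lex_product G1 G2}) : ~~ vertex_cut S.
    rewrite /vertex_cut negb_or negbK; apply/andP; split.
      by apply/forallP => p; case: (L0 (val p)).
    by rewrite eq_card0 // => p; case: (L0 (val p)).
  have /min_card_infty : forall S, ~~ @vertex_cut (lex_product G1 G2) S by [].
  rewrite /connectivity => ->; apply/min_card_infty => S.
  by rewrite negb_and nocut.
(* The empty graph is complete, so [G1] has a vertex and its connectivity is a finite [m]. *)
have G1_gt0 : 0 < #|G1|.
  by have /forallPn[x _] := G1_noncomplete; apply/card_gt0P; exists x.
case km : (connectivity G1) (connectivity_fin G1_gt0) k1G1 => [m|] // _ k1m.
have /min_cardP[[S cutS cardS] _] := k1m.
have /min_cardP[_ minm] := km.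
have cutL := fibres_k1_vertex_cut _ G2 _ G2_gt0 cutS.
have minL T : @vertex_cut (lex_product G1 G2) T -> m * #|G2| <= #|T|.
  move=> /full_fibres_vertex_cut/minm le_mT.
  by apply: leq_trans (leq_card_full_fibres _ _ _); rewrite leq_mul2r le_mT orbT.
transitivity (Some (m * #|G2|)); last symmetry; apply/min_cardP; split.
- by exists (fibres _ G2 S); rewrite ?card_fibres ?cardS.
- by move=> T /andP[/minL].
- exists (fibres _ G2 S); last by rewrite card_fibres cardS.
  by case/andP: cutL.
- exact: minL.
Qed.
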